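(* Let $\Psi$ be a bounded (nonempty) subset of $\mathbb{R}^{n\times n}_+$. Then $$\mu(\Psi) = \inf_{\|\cdot\|}\ \sup_{A\in\Psi}\ \eta_{\|\cdot\|}(A),$$ where the infimum is over all norms $\|\cdot\|$ on $\mathbb{R}^n$.
   Context: $\mathbb{R}^n_+$ and $\mathbb{R}^{n\times n}_+$ are the sets of vectors and of $n\times n$ matrices with nonnegative real entries. Max-algebraic operations: $a\oplus b=\max\{a,b\}$ and $a\otimes b=ab$ on $\mathbb{R}_+$, extended to matrices and vectors by $(A\otimes B)_{ij}=\max_k a_{ik}b_{kj}$ and $(A\otimes x)_i=\max_k a_{ik}x_k$. For $A\in\mathbb{R}^{n\times n}_+$, the maximal cycle geometric mean is $\mu(A)=\max\{(a_{i_1i_2}a_{i_2i_3}\cdots a_{i_ki_1})^{1/k} \mid k\ge 1,\ 1\le i_1,\dots,i_k\le n \text{ distinct}\}$. For a bounded set $\Psi\subseteq\mathbb{R}^{n\times n}_+$ and $m\ge1$, $\Psi^m_\otimes=\{A_1\otimes\cdots\otimes A_m\mid A_j\in\Psi\}$. The max-algebraic joint spectral radius of $\Psi$ is $\mu(\Psi)=\limsup_{m\to\infty}\left(\sup_{A\in\Psi^m_\otimes}\mu(A)\right)^{1/m}$. For a norm $\|\cdot\|$ on $\mathbb{R}^n$ and $A\in\mathbb{R}^{n\times n}_+$, the max-induced norm is $\eta_{\|\cdot\|}(A)=\max_{x>0}\frac{\|A\otimes x\|}{\|x\|}$, where $x>0$ means $x\in\mathbb{R}^n_+$, $x\neq0$.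 *)

(* Defs.v *)
From HB Require Import structures.
From mathcomp Require Import all_boot all_order all_algebra.
From mathcomp Require Import all_classical all_reals all_analysis.

Set Implicit Arguments.
Unset Strict Implicit.
Unset Printing Implicit Defensive.

Import Order.TTheory GRing.Theory Num.Theory.
Import numFieldNormedType.Exports.

Local Open Scope classical_set_scope.
Local Open Scope ring_scope.

Section MaxAlgebra.
Context {R : realType}.

Definition nonneg_mx {m n : nat} (A : 'M[R]_(m, n)) : Prop :=
  forall i j, 0 <= A i j.

(* Max-algebraic product; with n = 1 it is the action on column vectors.
   These definitions are meant for nonnegative matrices of positive size: the
   default value 0 of the maxima is then immaterial. *)
Definition maxmul {m p n : nat} (A : 'M[R]_(m, p)) (B : 'M[R]_(p, n)) :
    'M[R]_(m, n) :=
  \matrix_(i, j) \big[Num.max/0]_(k < p) (A i k * B k j).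

(* A cycle of length k.+1 is an injective c : 'I_k.+1 -> 'I_n, read cyclically
   (ordS is the successor modulo k.+1); distinctness forces k < n. *)
Definition cycle_gmean {n : nat} (A : 'M[R]_n) (k : nat)
    (c : {ffun 'I_k.+1 -> 'I_n}) : R :=
  (\prod_(j < k.+1) A (c j) (c (ordS j))) `^ (k.+1%:R^-1).

Definition max_cycle_gmean {n : nat} (A : 'M[R]_n) : R :=
  \big[Num.max/0]_(k < n)
    \big[Num.max/0]_(c : {ffun 'I_k.+1 -> 'I_n} | injectiveb c)
      cycle_gmean A c.

(* 1%:M is also the unit of maxmul on nonnegative matrices. *)
Definition maxprods {n : nat} (Psi : set 'M[R]_n) (m : nat) : set 'M[R]_n :=
  [set \big[maxmul/1%:M]_(j < m) A j
    | A in [set A : 'I_m -> 'M[R]_n | forall j, Psi (A j)]].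

(* Indexed by m.+1 since only products of at least one factor are considered. *)
Definition max_jsr {n : nat} (Psi : set 'M[R]_n) : \bar R :=
  limn_esup (fun m : nat =>
    (ereal_sup [set (max_cycle_gmean A)%:E | A in maxprods Psi m.+1]
       `^ (m.+1%:R^-1))%E).

Record is_norm {n : nat} (N : 'cV[R]_n -> R) : Prop := IsNorm {
  is_norm_ler_normD : forall x y, N (x + y) <= N x + N y ;
  is_norm_normrZ : forall (l : R) x, N (l *: x) = `|l| * N x ;
  is_norm_normr0_eq0 : forall x, N x = 0 -> x = 0 }.

Definition max_induced_norm {n : nat} (N : 'cV[R]_n -> R) (A : 'M[R]_n) :
    \bar R :=
  ereal_sup [set (N (maxmul A x) / N x)%:E
              | x in [set x : 'cV[R]_n | nonneg_mx x /\ x != 0]].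

End MaxAlgebra.

(* Main.v *)
(** If [r] exceeds the joint spectral radius, every closed walk that uses at each
step an arbitrary matrix of [Psi] has weight at most [r ^ length], since
otherwise repeating it would give products of arbitrarily large length with a
diagonal entry at least [r ^ length]. Deleting cycles then bounds the weight,
divided by [r ^ length], of all walks; its supremum [u i] over the walks starting
at [i] satisfies [A i j * u j <= r * u i] for all [A] in [Psi], which says exactly
that the norm [max_i |x i| / u i] has induced norm at most [r] on [Psi].

Conversely, if [N (A x) <= c * N x] on [Psi], then a product [P] of [m] factors
satisfies [N (P x) <= c ^ m * N x]. Starting from the unit vector of a vertex of
a cycle of [P] and iterating around the cycle, the growth of that coordinate,
which [N] dominates since all norms are equivalent, bounds the cycle mean by
[c ^ m]. *)

Require Import Defs.
From mathcomp Require Import all_boot all_order all_algebra.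
From mathcomp Require Import all_classical all_reals all_analysis.
From mathcomp Require Import ring lra.
Import Order.TTheory GRing.Theory Num.Theory.
Import numFieldNormedType.Exports.
Local Open Scope classical_set_scope.
Local Open Scope ring_scope.

(** * Products in the max algebra *)

Lemma maxmul_nonneg {R : realType} {m p n : nat} (A : 'M[R]_(m, p))
    (B : 'M[R]_(p, n)) : nonneg_mx (maxmul A B).
Proof. by move=> i j; rewrite mxE; exact: bigmax_ge_id. Qed.

Lemma le_maxmul {R : realType} {m p n : nat} (A : 'M[R]_(m, p))
    (B : 'M[R]_(p, n)) i k j : A i k * B k j <= maxmul A B i j.
Proof. by rewrite mxE; exact: (le_bigmax 0 (fun k => A i k * B k j)). Qed.

Lemma maxmul_le {R : realType} {m p n : nat} (A : 'M[R]_(m, p))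
    (B : 'M[R]_(p, n)) i j (c : R) :
  0 <= c -> (forall k, A i k * B k j <= c) -> maxmul A B i j <= c.
Proof. by move=> c0 h; rewrite mxE; apply: bigmax_le. Qed.

(** A nonnegative scalar distributes over the maximum. The proof divides by [a], so [a = 0] is split
    off first. *)
Lemma maxmul_mulr_le {R : realType} {m p n : nat} (A : 'M[R]_(m, p))
    (B : 'M[R]_(p, n)) i j (a c : R) : 0 <= a -> 0 <= c ->
  (forall k, A i k * B k j * a <= c) -> maxmul A B i j * a <= c.
Proof.
rewrite le_eqVlt => /predU1P[<- c0 _|a0 c0 h]; first by rewrite mulr0.
rewrite -ler_pdivlMr//; apply: maxmul_le => [|k]; first by rewrite divr_ge0// ltW.
by rewrite ler_pdivlMr.
Qed.

Lemma maxmulA {R : realType} {m p q n : nat} (A : 'M[R]_(m, p))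
    (B : 'M[R]_(p, q)) (C : 'M[R]_(q, n)) :
  nonneg_mx A -> nonneg_mx B -> nonneg_mx C ->
  maxmul (maxmul A B) C = maxmul A (maxmul B C).
Proof.
move=> A0 B0 C0; apply/matrixP => i j; apply/eqP; rewrite eq_le.
apply/andP; split; apply: maxmul_le; rewrite ?maxmul_nonneg// => k.
- apply: maxmul_mulr_le => [//||l]; first exact: maxmul_nonneg.
  rewrite -mulrA; apply: le_trans (le_maxmul _ _ _ l _).
  by rewrite ler_wpM2l ?le_maxmul.
- rewrite mulrC; apply: maxmul_mulr_le => [//||l]; first exact: maxmul_nonneg.
  rewrite mulrC mulrA; apply: le_trans (le_maxmul _ _ _ l _).
  by rewrite ler_wpM2r ?le_maxmul.
Qed.

Lemma maxmul1mx {R : realType} {n p : nat} (A : 'M[R]_(n, p)) :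
  nonneg_mx A -> maxmul 1%:M A = A.
Proof.
move=> A0; apply/matrixP => i j; apply/eqP; rewrite eq_le; apply/andP; split.
  apply: maxmul_le => // k; rewrite mxE.
  by have [->|_] := eqVneq i k; rewrite ?mul1r ?mul0r.
by apply: le_trans (le_maxmul _ _ _ i _); rewrite mxE eqxx mul1r.
Qed.

Lemma nonneg_mx1 {R : realType} {n : nat} : nonneg_mx (1%:M : 'M[R]_n).
Proof. by move=> i j; rewrite mxE ler0n. Qed.

Lemma bigmaxmul_nonneg {R : realType} {n : nat} (s : seq 'M[R]_n) :
  nonneg_mx (\big[maxmul/1%:M]_(A <- s) A).
Proof.
case: s => [|A s]; first by rewrite big_nil; exact: nonneg_mx1.
by rewrite big_cons; exact: maxmul_nonneg.
Qed.

(** Lists replace functions on ['I_m], so that walks can supply the factors and products can be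
    handled by induction. *)
Lemma maxprodsP {R : realType} {n : nat} (Psi : set 'M[R]_n) m (P : 'M[R]_n) :
  maxprods Psi m P <->
  exists s, [/\ size s = m, forall A, A \in s -> Psi A &
                P = \big[maxmul/1%:M]_(A <- s) A].
Proof.
split=> [[A /= PsiA <-]|[s [<- Psis ->]]].
  exists [tuple A j | j < m]; split; first by rewrite size_tuple.
    by move=> _ /mapP[j _ ->].
  by rewrite big_tuple; apply: eq_bigr => j _; rewrite tnth_mktuple.
exists (tnth (in_tuple s)) => /=; last by rewrite [RHS]big_tnth.
by move=> j; apply/Psis/mem_tnth.
Qed.

Lemma diag_le_max_cycle_gmean {R : realType} {n : nat} (A : 'M[R]_n) i :
  0 <= A i i -> A i i <= max_cycle_gmean A.
Proof.
move=> Aii; have n0 : (0 < n)%N by case: (i) => j; exact: leq_ltn_trans.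
apply: le_trans (le_bigmax _ _ (Ordinal n0)) => /=.
(* The diagonal entry is the mean of the loop at [i], a cycle of length one. *)
pose c := [ffun=> i] : {ffun 'I_1 -> 'I_n}.
have cinj : injectiveb c by apply/injectiveP => x y _; rewrite !ord1.
apply: le_trans (le_bigmax_cond _ _ cinj).
by rewrite /cycle_gmean big_ord1 !ffunE invr1 powRr1.
Qed.

(** * Walks *)

(* A walk from [i] lists its steps as pairs (matrix used, vertex reached); its
   weight is normalised by a factor [1 / r] per step. *)
Fixpoint walk_weight {R : realType} {n : nat} (r : R) (i : 'I_n)
    (s : seq ('M[R]_n * 'I_n)) : R :=
  if s is (A, j) :: s' then A i j / r * walk_weight r j s' else 1.

Definition walk_end {R : realType} {n : nat} (i : 'I_n)
  (s : seq ('M[R]_n * 'I_n)) : 'I_n := last i (map snd s).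

Section Walks.
Context {R : realType} {n : nat}.
Implicit Types (r : R) (i j : 'I_n) (A : 'M[R]_n) (s : seq ('M[R]_n * 'I_n)).

Lemma walk_weight_cat r i s1 s2 :
  walk_weight r i (s1 ++ s2) =
  walk_weight r i s1 * walk_weight r (walk_end i s1) s2.
Proof.
elim: s1 i => [|[A j] s1 IH] i /=; first by rewrite mul1r.
by rewrite IH mulrA.
Qed.

Lemma walk_weight_flatten_nseq r i s t : walk_end i s = i ->
  walk_weight r i (flatten (nseq t s)) = walk_weight r i s ^+ t /\
  walk_end i (flatten (nseq t s)) = i.
Proof.
move=> si; elim: t => [|t [IHw IHe]] //=; rewrite walk_weight_cat si IHw exprS.
by rewrite /walk_end map_cat last_cat -/(walk_end i s) si.
Qed.

Variable Psi : set 'M[R]_n.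
Hypothesis Psi_nonneg : forall A, Psi A -> nonneg_mx A.
Let in_Psi s := forall p, p \in s -> Psi p.1.

Lemma walk_weight_ge0 r i s : 0 < r -> in_Psi s -> 0 <= walk_weight r i s.
Proof.
move=> r0; elim: s i => [|[A j] s IH] i //= Psis; rewrite mulr_ge0//.
  by rewrite divr_ge0 ?(ltW r0)//; apply: Psi_nonneg; apply: (Psis (A, j)); rewrite mem_head.
by apply: IH => p ps; apply: Psis; rewrite inE ps orbT.
Qed.

(** The walk is one of the candidates in the iterated maximum; the power of [r] undoes the
    normalisation of its weight. *)
Lemma walk_weight_le_maxprod r i s : 0 < r -> in_Psi s ->
  walk_weight r i s * r ^+ size s
    <= (\big[maxmul/1%:M]_(p <- s) p.1) i (walk_end i s).
Proof.
move=> r0; elim: s i => [|[A j] s IH] i Psis /=.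
  by rewrite big_nil mxE eqxx mulr1.
rewrite big_cons; apply: le_trans (le_maxmul _ _ _ j _).
have -> : A i j / r * walk_weight r j s * r ^+ (size s).+1 =
    A i j * (walk_weight r j s * r ^+ size s).
  by rewrite exprS; field; rewrite gt_eqF.
rewrite ler_wpM2l//.
  by apply: Psi_nonneg; apply: (Psis (A, j)); rewrite mem_head.
by apply: IH => p ps; apply: Psis; rewrite inE ps orbT.
Qed.

(** The tail is shortened first. If [i] reappears in it, the part up to that return is a closed walk
    of weight at most 1, and dropping it does not lower the weight. *)
Lemma walk_shorten r i s : 0 < r ->
  (forall j t, in_Psi t -> walk_end j t = j -> walk_weight r j t <= 1) ->
  in_Psi s ->
  exists t, [/\ in_Psi t, uniq (i :: map snd t) &
                walk_weight r i s <= walk_weight r i t].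
Proof.
move=> r0 closed_le1; elim: s i => [|[A j] s IH] i Psis.
  by exists [::]; split.
have PsiA : Psi A by apply: (Psis (A, j)); rewrite mem_head.
have [|t [Psit tuniq st]] := IH j.
  by move=> p ps; apply: Psis; rewrite inE ps orbT.
pose t' := (A, j) :: t.
have Psit' : in_Psi t' by move=> p; rewrite inE => /predU1P[->//|/Psit].
have st' : walk_weight r i ((A, j) :: s) <= walk_weight r i t'.
  by rewrite /= ler_wpM2l// divr_ge0 ?(ltW r0)//; exact: Psi_nonneg.
have [it'|it'] := boolP (i \in map snd t'); last first.
  by exists t'; split => //; rewrite cons_uniq it'.
have /splitPr t'E : i \in map snd t' by [].
move Em : (map snd t') t'E => m t'E; case: t'E Em => p1 p2 Em.
(* The first [k] steps end with the return to [i]; [p2] lists the vertices reached afterwards. *)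
pose k := (size p1).+1.
have takeE : map snd (take k t') = rcons p1 i.
  by rewrite map_take Em -cat_rcons take_size_cat// size_rcons.
have dropE : map snd (drop k t') = p2.
  by rewrite map_drop Em -cat_rcons drop_size_cat// size_rcons.
have take_end : walk_end i (take k t') = i.
  by rewrite /walk_end takeE last_rcons.
have Psid : in_Psi (drop k t') by move=> p /mem_drop; exact: Psit'.
exists (drop k t'); split => //.
  have : uniq (map snd t') by [].
  by rewrite Em dropE cat_uniq => /and3P[].
apply: (le_trans st'); rewrite -{1}(cat_take_drop k t') walk_weight_cat take_end.
rewrite ler_piMl ?walk_weight_ge0// closed_le1// => p /mem_take; exact: Psit'.
Qed.

(** The base is kept at least 1 so that the bound increases with the length and a bound on the
    length suffices. *)
Lemma walk_weight_bounded r K i s : 0 < r ->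
  (forall A, Psi A -> forall i j, A i j <= K) -> in_Psi s ->
  walk_weight r i s <= Num.max 1 (K / r) ^+ size s.
Proof.
move=> r0 PsiK; elim: s i => [|[A j] s IH] i Psis //=.
have PsiA : Psi A by apply: (Psis (A, j)); rewrite mem_head.
have Psis' : in_Psi s by move=> p ps; apply: Psis; rewrite inE ps orbT.
rewrite exprS ler_pM ?walk_weight_ge0 ?IH//.
  by rewrite divr_ge0 ?(ltW r0)//; exact: Psi_nonneg.
by rewrite le_max ler_pM2r ?invr_gt0// PsiK ?orbT.
Qed.

Lemma exists_potential r K : 0 < r ->
  (forall A, Psi A -> forall i j, A i j <= K) ->
  (forall j t, in_Psi t -> walk_end j t = j -> walk_weight r j t <= 1) ->
  exists u : 'I_n -> R, (forall i, 0 < u i) /\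
    (forall A i j, Psi A -> A i j * u j <= r * u i).
Proof.
move=> r0 PsiK closed_le1.
pose W i := [set walk_weight r i s | s in [set s | in_Psi s]].
have W1 i : W i 1 by exists [::].
have ubW i : has_ubound (W i).
  exists (Num.max 1 (K / r) ^+ n) => _ [s Psis <-].
  have [t [Psit tuniq st]] := walk_shorten r i s r0 closed_le1 Psis.
  (* The vertices of [t], with its start, are distinct, so [t] has fewer than [n] steps. *)
  apply: (le_trans st); apply: (le_trans (walk_weight_bounded r K i t _ _ _)) => //.
  rewrite ler_weXn2l// ?le_max ?lexx//.
  have /card_uniqP := tuniq; rewrite /= size_map => tn.
  by apply: ltnW; rewrite -tn -[X in (_ <= X)%N]card_ord max_card.
exists (fun i => sup (W i)); split=> [i|A i j PsiA].
  exact: lt_le_trans ltr01 (ub_le_sup (ubW i) (W1 i)).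
have [->|Aij] := eqVneq (A i j) 0.
  by rewrite mul0r mulr_ge0 ?(ltW r0)//; exact: le_trans ler01 (ub_le_sup (ubW i) (W1 i)).
have {}Aij : 0 < A i j by rewrite lt_def Aij /=; exact: Psi_nonneg.
rewrite mulrC -ler_pdivlMr//; apply: ge_sup; first by exists 1.
(* Prepending the step [(A, j)] to a walk from [j] gives a walk from [i], whose weight is bounded by
   the supremum at [i]. *)
move=> _ [s Psis <-]; rewrite ler_pdivlMr// mulrC -ler_pdivrMl// mulrA (mulrC r^-1).
apply: ub_le_sup => //; exists ((A, j) :: s) => //.
by move=> p; rewrite inE => /predU1P[->//|/Psis].
Qed.

End Walks.

(** * Limits superior and the weight of closed walks *)

Lemma limn_esup_lt {R : realType} (u : nat -> \bar R) (x : \bar R) :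
  (limn_esup u < x)%E -> exists N, forall m, (N <= m)%N -> (u m < x)%E.
Proof.
rewrite /limn_esup limf_esupE => /ereal_inf_lt[_ [V [N _ NV] <-]] Vx.
exists N => m Nm; apply: le_lt_trans Vx.
by apply: ereal_sup_ubound; exists m => //; exact: NV.
Qed.

Lemma limn_esup_le {R : realType} (u : nat -> \bar R) (x : \bar R) :
  (forall m, (u m <= x)%E) -> (limn_esup u <= x)%E.
Proof.
move=> ux; rewrite /limn_esup limf_esupE.
apply: le_trans (_ : (ereal_sup (u @` setT) <= x)%E); last first.
  by apply: ge_ereal_sup => _ [m _ <-].
by apply: ereal_inf_lbound; exists setT => //; exact: filterT.
Qed.

Lemma jsr_lt_gt0 {R : realType} {n : nat} (Psi : set 'M[R]_n) (r : R) :
  (max_jsr Psi < r%:E)%E -> 0 < r.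
Proof.
move=> /limn_esup_lt[N /(_ N (leqnn N))]; rewrite -lte_fin.
by apply: le_lt_trans; exact: poweR_ge0.
Qed.

(* Going t times around a closed walk of normalised weight > 1 gives products of
   arbitrarily large length whose cycle mean is at least r ^+ length. *)
Lemma closed_walk_weight_le1 {R : realType} {n : nat} (Psi : set 'M[R]_n)
    (Psi_nonneg : forall A, Psi A -> nonneg_mx A) (r : R) i s :
  (max_jsr Psi < r%:E)%E -> (forall p, p \in s -> Psi p.1) ->
  walk_end i s = i -> walk_weight r i s <= 1.
Proof.
move=> jsr_r Psis si; have r0 := jsr_lt_gt0 Psi r jsr_r.
have [//|w1] := leP (walk_weight r i s) 1.
have s0 : (0 < size s)%N by case: (s) w1 => //=; rewrite ltxx.
have [N uN] := limn_esup_lt _ _ jsr_r.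
(* With [N.+1] rounds the length exceeds [N]; as [max_jsr] indexes products of length [m.+1] by [m],
   this gives [N <= m]. *)
pose t := flatten (nseq N.+1 s).
have [tw te] := walk_weight_flatten_nseq r i s N.+1 si.
rewrite -/t in tw te.
have Psit p : p \in t -> Psi p.1.
  by move=> /flattenP[_ /nseqP[-> _]]; exact: Psis.
have tN : (N < size t)%N.
  rewrite size_flatten /shape map_nseq sumn_nseq.
  by rewrite -[X in (X < _)%N]mul1n; apply: (leq_mul s0 (leqnn N.+1)).
have [m mE] : exists m, size t = m.+1.
  by exists (size t).-1; rewrite prednK// (leq_ltn_trans _ tN).
have Nm : (N <= m)%N by rewrite -ltnS -mE.
(* It remains to contradict [uN] by showing that the term of index [m] is at least [r]. *)
have := uN m Nm; apply: contraTT => _; rewrite -leNgt.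
pose P := \big[maxmul/1%:M]_(p <- t) p.1.
have PsiP : maxprods Psi m.+1 P.
  apply/maxprodsP; exists (map fst t); split; first by rewrite size_map.
    by move=> _ /mapP[p /Psit ? ->].
  by rewrite big_map.
have rP : r ^+ m.+1 <= max_cycle_gmean P.
  apply: le_trans (diag_le_max_cycle_gmean P i _); last first.
    by rewrite /P -(big_map fst xpredT id); exact: bigmaxmul_nonneg.
  apply: le_trans (_ : walk_weight r i t * r ^+ size t <= _).
    by rewrite tw mE ler_peMl ?exprn_ge0 ?(ltW r0)// exprn_ege1// ltW.
  by rewrite -[X in P i X]te; exact: (walk_weight_le_maxprod Psi).
have -> : r%:E = ((r ^+ m.+1)%:E `^ m.+1%:R^-1)%E.
  by rewrite poweR_EFin -powR_mulrn ?(ltW r0)// -powRrM divff// powRr1// ?(ltW r0).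
have rE : ((r ^+ m.+1)%:E <=
    ereal_sup [set (max_cycle_gmean A)%:E | A in maxprods Psi m.+1])%E.
  apply: le_trans (_ : ((max_cycle_gmean P)%:E <= _)%E); first by rewrite lee_fin.
  by apply: ereal_sup_ubound; exists P.
have rm0 : (0 <= (r ^+ m.+1)%:E)%E by rewrite lee_fin exprn_ge0// ltW.
by apply: (@gt0_ler_poweR _ m.+1%:R^-1 _ _ _ _ _ rE);
  rewrite ?invr_ge0// in_itv/= ?leey ?andbT// (le_trans rm0 rE).
Qed.

(** * Norms *)

Definition weighted_norm {R : realType} {n : nat} (u : 'I_n -> R)
  (x : 'cV[R]_n) : R := \big[Num.max/0]_i (`|x i 0| / u i).

Lemma weighted_norm_is_norm {R : realType} {n : nat} (u : 'I_n -> R) :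
  (forall i, 0 < u i) -> is_norm (weighted_norm u).
Proof.
move=> u0.
have le_wn (x : 'cV[R]_n) i : `|x i 0| / u i <= weighted_norm u x.
  exact: (le_bigmax 0 (fun i => `|x i 0| / u i)).
have wn0 x : 0 <= weighted_norm u x by exact: bigmax_ge_id.
split.
- move=> x y; apply: bigmax_le => [|i _]; first exact: addr_ge0.
  apply: le_trans (lerD (le_wn x i) (le_wn y i)).
  by rewrite -mulrDl ler_pM2r ?invr_gt0// mxE ler_normD.
- move=> l x; apply/eqP; rewrite eq_le; apply/andP; split.
    apply: bigmax_le => [|i _]; first exact: mulr_ge0.
    by rewrite mxE normrM -mulrA ler_wpM2l.
  have [->|l0] := eqVneq l 0; first by rewrite normr0 mul0r.
  rewrite -ler_pdivlMl ?normr_gt0//; apply: bigmax_le => [|i _].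
    by rewrite mulr_ge0 ?invr_ge0.
  rewrite ler_pdivlMl ?normr_gt0// mulrA -normrM.
  by have := le_wn (l *: x) i; rewrite mxE.
- move=> x x0; apply/matrixP => i j; rewrite ord1 mxE; apply/eqP.
  rewrite -normr_le0; have := le_wn x i; rewrite x0.
  by rewrite ler_pdivrMr// mul0r.
Qed.

Lemma is_norm0 {R : realType} {n : nat} (N : 'cV[R]_n -> R) :
  is_norm N -> N 0 = 0.
Proof. by case=> _ NZ _; rewrite -(scale0r 0) NZ normr0 mul0r. Qed.

Lemma is_normN {R : realType} {n : nat} (N : 'cV[R]_n -> R) x :
  is_norm N -> N (- x) = N x.
Proof. by case=> _ NZ _; rewrite -scaleN1r NZ normrN1 mul1r. Qed.

(** Nonnegativity follows from [0 = N (x - x) <= 2 * N x]. *)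
Lemma is_norm_ge0 {R : realType} {n : nat} (N : 'cV[R]_n -> R) x :
  is_norm N -> 0 <= N x.
Proof.
move=> normN; have := is_norm_ler_normD normN x (- x).
by rewrite subrr is_norm0// is_normN//; lra.
Qed.

Lemma is_norm_gt0 {R : realType} {n : nat} (N : 'cV[R]_n -> R) x :
  is_norm N -> x != 0 -> 0 < N x.
Proof.
move=> normN x0; rewrite lt_def is_norm_ge0// andbT.
by apply: contra x0 => /eqP /(is_norm_normr0_eq0 normN) ->.
Qed.

Lemma max_induced_norm_weighted_le {R : realType} {n : nat} (u : 'I_n -> R)
    (A : 'M[R]_n) (r : R) : (forall i, 0 < u i) -> 0 < r -> nonneg_mx A ->
  (forall i j, A i j * u j <= r * u i) ->
  (max_induced_norm (weighted_norm u) A <= r%:E)%E.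
Proof.
move=> u0 r0 A0 Au; apply: ge_ereal_sup => _ [x [x0 xN0] <-].
have wn := weighted_norm_is_norm u u0.
rewrite lee_fin ler_pdivrMr ?is_norm_gt0//.
have rx0 : 0 <= r * weighted_norm u x by rewrite mulr_ge0 ?(ltW r0) ?is_norm_ge0.
apply: bigmax_le => // i _.
rewrite ger0_norm; last exact: maxmul_nonneg.
rewrite ler_pdivrMr//; apply: maxmul_le => [|j].
  by rewrite mulr_ge0// ltW.
(* By definition of the weighted norm, [x j] is at most [u j] times the norm of [x]. *)
apply: le_trans (_ : A i j * (u j * weighted_norm u x) <= _).
  rewrite ler_wpM2l// mulrC -ler_pdivrMr//.
  by apply: le_trans (le_bigmax 0 (fun i => `|x i 0| / u i) j); rewrite ger0_norm.
by rewrite mulrA [leRHS]mulrAC ler_wpM2r ?is_norm_ge0.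
Qed.

Lemma le_entry_mx_norm {R : realType} {m n : nat} (A : 'M[R]_(m, n)) i j :
  `|A i j| <= `|A|.
Proof.
rewrite [leRHS]/Num.norm /= mx_normrE.
exact: (le_bigmax 0 (fun ij : 'I_m * 'I_n => `|A ij.1 ij.2|) (i, j)).
Qed.

Lemma bounded_set_entries {R : realType} {n : nat} (Psi : set 'M[R]_n) :
  bounded_set Psi -> exists K, forall A, Psi A -> forall i j, A i j <= K.
Proof.
(* [bM] applies only to bounds strictly above [M], hence [M + 1]. *)
move=> [M [Mreal bM]]; exists (M + 1) => A PsiA i j.
apply: le_trans (bM (M + 1) _ A PsiA); last by rewrite ltrDl.
exact: le_trans (ler_norm _) (le_entry_mx_norm A i j).
Qed.

Lemma jsr_lt_induced_norm_le {R : realType} {n : nat} (Psi : set 'M[R]_n) r :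
  (forall A, Psi A -> nonneg_mx A) -> bounded_set Psi ->
  (max_jsr Psi < r%:E)%E ->
  exists2 N : 'cV[R]_n -> R, is_norm N &
    (ereal_sup [set max_induced_norm N A | A in Psi] <= r%:E)%E.
Proof.
move=> Psi_nonneg /bounded_set_entries[K PsiK] jsr_r.
have r0 := jsr_lt_gt0 Psi r jsr_r.
have [|u [u0 Au]] := exists_potential Psi Psi_nonneg r K r0 PsiK.
  by move=> j t; exact: closed_walk_weight_le1.
exists (weighted_norm u); first exact: weighted_norm_is_norm.
apply: ge_ereal_sup => _ [A PsiA <-].
apply: max_induced_norm_weighted_le => //; first exact: Psi_nonneg.
by move=> i j; exact: Au.
Qed.

(** * Comparison of an arbitrary norm with the entries *)

Lemma is_norm_sum_le {R : realType} {n : nat} (N : 'cV[R]_n -> R) I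
    (s : seq I) (F : I -> 'cV[R]_n) :
  is_norm N -> N (\sum_(i <- s) F i) <= \sum_(i <- s) N (F i).
Proof.
move=> normN; elim/big_rec2 : _ => [|i y x _ xy]; first by rewrite is_norm0.
by apply: le_trans (is_norm_ler_normD normN _ _) _; rewrite lerD2l.
Qed.

(** Expand [x] in the unit vectors. Row vectors appear because the compactness argument below takes
    place among them. *)
Lemma is_norm_le_mx_norm {R : realType} {n : nat} (N : 'cV[R]_n -> R) :
  is_norm N -> exists2 K, 0 < K & forall x : 'rV[R]_n, N x^T <= K * `|x|.
Proof.
move=> normN; pose K := \sum_(i < n) N (delta_mx i 0).
have K0 : 0 <= K by apply: sumr_ge0 => i _; exact: is_norm_ge0.
(* The sum [K] is empty when [n = 0]; adding 1 keeps the constant positive. *)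
exists (K + 1); first by rewrite ltr_wpDl.
move=> x; apply: le_trans (_ : K * `|x| <= _); last by rewrite ler_wpM2r// lerDl.
have -> : x^T = \sum_i x 0 i *: delta_mx i 0.
  apply/matrixP => i j; rewrite ord1 mxE summxE (bigD1 i)//= big1 => [|k ki].
    by rewrite !mxE !eqxx mulr1 addr0.
  by rewrite !mxE eq_sym (negbTE ki) mulr0.
apply: le_trans (is_norm_sum_le N _ _ _ normN) _.
rewrite /K mulr_suml; apply: ler_sum => i _.
rewrite (is_norm_normrZ normN) mulrC ler_wpM2l ?is_norm_ge0//.
exact: le_entry_mx_norm.
Qed.

(** The triangle inequality makes [N] Lipschitz with the constant of the previous bound. *)
Lemma is_norm_continuous {R : realType} {n : nat} (N : 'cV[R]_n -> R) :
  is_norm N -> continuous (fun x : 'rV[R]_n => N x^T).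
Proof.
move=> normN; have [K K0 NK] := is_norm_le_mx_norm N normN.
have lip (x y : 'rV[R]_n) : `|N x^T - N y^T| <= K * `|x - y|.
  have le1 (a b : 'rV[R]_n) : N a^T - N b^T <= K * `|a - b|.
    rewrite lerBlDr; apply: le_trans (_ : N (a - b)^T + N b^T <= _).
      apply: le_trans (is_norm_ler_normD normN _ _).
      by rewrite -linearD subrK.
    by rewrite lerD2r.
  by rewrite ler_norml le1 andbT lerNl opprB distrC le1.
move=> x; apply/(@cvgrPdist_le _ _ _ (nbhs x) (nbhs_filter x)) => e e0.
have /nbhs_ballP[d d0 xd] : nbhs x (ball x (K^-1 * e)).
  by apply: nbhsx_ballx; rewrite mulr_gt0 ?invr_gt0.
apply/nbhs_ballP; exists d => // y /xd; rewrite -ball_normE /= => /ltW xy.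
by apply: le_trans (lip x y) _; rewrite -ler_pdivlMl.
Qed.

(** By compactness [N] attains a positive minimum on the unit sphere of the entrywise maximum norm;
    its inverse serves as [C] by homogeneity. *)
Lemma entry_le_is_norm {R : realType} {n : nat} (N : 'cV[R]_n -> R) :
  is_norm N -> exists2 C, 0 < C & forall (x : 'cV[R]_n) i, x i 0 <= C * N x.
Proof.
case: n N => [|n] N normN; first by exists 1 => // x [].
pose S : set 'rV[R]_n.+1 := [set x | `|x| = 1].
have S_normalize (x : 'rV[R]_n.+1) : x != 0 -> S (`|x|^-1 *: x).
  by move=> x0; rewrite /S /= normrZ normfV normr_id mulVf// normr_eq0.
have S0 : S !=set0.
  exists (`|const_mx 1 : 'rV[R]_n.+1|^-1 *: const_mx 1); apply: S_normalize.
  by apply/eqP => /matrixP/(_ 0 0)/eqP; rewrite !mxE oner_eq0.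
have Scompact : compact S.
  apply: bounded_closed_compact.
    by exists 1; split => // M M1 x /= ->; exact: ltW.
  rewrite (_ : S = (fun x : 'rV[R]_n.+1 => `|x|) @^-1` [set 1])//.
  apply: closed_comp => [x _|]; [exact: norm_continuous|exact: closed_eq].
have Ncont : {within S, continuous (fun x : 'rV[R]_n.+1 => N x^T)}.
  exact: continuous_subspaceT (is_norm_continuous N normN).
have [c /set_mem cS cmin] := compact_EVT_min S0 Scompact Ncont.
have c0 : c^T != 0.
  apply/eqP => cT0; have : c = 0 by apply: trmx_inj; rewrite cT0 trmx0.
  by move=> c_eq0; move: cS; rewrite /S /= c_eq0 normr0 => /esym/eqP; rewrite oner_eq0.
have Nc := is_norm_gt0 N _ normN c0.
exists (N c^T)^-1; first by rewrite invr_gt0.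
move=> x i; have [->|x0] := eqVneq x 0.
  by rewrite mxE mulr_ge0 ?invr_ge0 ?is_norm_ge0.
have xT0 : x^T != 0 by apply: contra x0 => /eqP xT0; rewrite -(trmxK x) xT0 trmx0.
have := cmin _ (mem_set (S_normalize _ xT0)).
rewrite linearZ /= trmxK (is_norm_normrZ normN) normfV normr_id.
rewrite ler_pdivlMl ?normr_gt0// => cx.
rewrite ler_pdivlMl//; apply: le_trans cx.
rewrite mulrC ler_pM2r//.
apply: le_trans (ler_norm _) _.
by have := le_entry_mx_norm x^T 0 i; rewrite mxE.
Qed.

(** * Cycle means bounded by the growth of a norm *)

Lemma expr_bounded_le {R : realType} (a b C : R) : 0 <= a -> 0 <= b ->
  (forall t, a ^+ t <= C * b ^+ t) -> a <= b.
Proof.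
move=> a0 b0 h; have [//|ba] := leP a b.
have {}a0 : 0 < a by exact: le_lt_trans ba.
have C0 : 0 < C.
  by have := h 0%N; rewrite !expr0 mulr1; exact: lt_le_trans.
(* If [b < a], these powers fall below [C^-1], against the hypothesis: a constant factor cannot
   affect the growth rate. *)
have : (fun t => (b / a) ^+ t) @ \oo --> (0 : R).
  apply: cvg_expr; rewrite ger0_norm ?divr_ge0 ?(ltW a0)//.
  by rewrite ltr_pdivrMr// mul1r.
move=> /cvgrPdist_lt /(_ C^-1); rewrite invr_gt0 => /(_ C0) [t _ /(_ t (leqnn t))] /=.
rewrite sub0r normrN ger0_norm ?exprn_ge0 ?divr_ge0 ?(ltW a0)//.
rewrite expr_div_n ltr_pdivrMr ?exprn_gt0// ltr_pdivlMl//.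
by rewrite ltNge h.
Qed.

(** A path contributes one candidate to the iterated maximum. Indexing it by [nat] lets the
    induction shift it by one step. *)
Lemma iter_maxmul_path {R : realType} {n : nat} (P : 'M[R]_n) (z : 'cV[R]_n)
    (f : nat -> 'I_n) m : nonneg_mx P ->
  (\prod_(j < m) P (f j) (f j.+1)) * z (f m) 0
    <= iter m (maxmul P) z (f 0%N) 0.
Proof.
move=> P0; elim: m f => [|m IH] f; first by rewrite big_ord0 mul1r.
rewrite big_ord_recl -mulrA iterS.
apply: le_trans (le_maxmul _ _ _ (f 1%N) _).
by rewrite ler_wpM2l//; exact: (IH (fun j => f j.+1)).
Qed.

Lemma max_cycle_gmean_le {R : realType} {n : nat} (N : 'cV[R]_n -> R)
    (P : 'M[R]_n) (d : R) : is_norm N -> nonneg_mx P -> 0 <= d ->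
  (forall z, nonneg_mx z -> N (maxmul P z) <= d * N z) ->
  max_cycle_gmean P <= d.
Proof.
move=> normN P0 d0 Pd; have [C C0 NC] := entry_le_is_norm N normN.
apply: bigmax_le => // k _; apply: bigmax_le => // c _.
rewrite /cycle_gmean; set v := \prod_(j < k.+1) _.
have v0 : 0 <= v by exact: prodr_ge0.
suff vd : v <= d ^+ k.+1.
  have -> : d = (d ^+ k.+1) `^ k.+1%:R^-1.
    by rewrite -powR_mulrn// -powRrM divff// powRr1.
  by apply: ge0_ler_powR; rewrite ?invr_ge0 ?nnegrE// exprn_ge0.
(* [g] is one full turn around the cycle, and [e] is the unit vector at its start. *)
pose g := iter k.+1 (maxmul P : 'cV[R]_n -> 'cV[R]_n).
pose e : 'cV[R]_n := delta_mx (c ord0) 0.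
have e0 : nonneg_mx e by move=> i j; rewrite mxE ler0n.
have iter0 m (z : 'cV[R]_n) : nonneg_mx z -> nonneg_mx (iter m (maxmul P) z).
  by case: m => // m _; exact: maxmul_nonneg.
have iterN m (z : 'cV[R]_n) : nonneg_mx z -> N (iter m (maxmul P) z) <= d ^+ m * N z.
  move=> z0; elim: m => [|m IH]; first by rewrite mul1r.
  rewrite iterS exprS -mulrA; apply: le_trans (Pd _ (iter0 m z z0)) _.
  by rewrite ler_wpM2l.
have gv (z : 'cV[R]_n) : v * z (c ord0) 0 <= g z (c ord0) 0.
  (* The cycle is unrolled into a path that is back at [c ord0] after [k.+1] steps. *)
  pose f j := c (inord (j %% k.+1)).
  have fE : v = \prod_(j < k.+1) P (f j) (f j.+1).
    apply: eq_bigr => j _; rewrite /f modn_small ?ltn_ord// inord_val.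
    by congr (P _ (c _)); apply/val_inj; rewrite /= inordK ?ltn_mod.
  have f0 : f 0%N = c ord0 by rewrite /f mod0n; congr (c _); apply/val_inj; rewrite /= inordK.
  have fk : f k.+1 = c ord0 by rewrite /f modnn; congr (c _); apply/val_inj; rewrite /= inordK.
  by rewrite fE -{1}fk -f0; exact: iter_maxmul_path.
have giter t : v ^+ t <= iter t g e (c ord0) 0.
  elim: t => [|t IH]; first by rewrite expr0 mxE !eqxx.
  by rewrite exprS iterS; apply: le_trans (gv _); rewrite ler_wpM2l.
(* After [t] turns the start coordinate is at least [v ^+ t], while its bound through [N] is
   [C * N e] times the [t]-th power of [d ^+ k.+1]. *)
apply: (expr_bounded_le _ _ (C * N e)) => //; first exact: exprn_ge0.
move=> t; apply: le_trans (giter t) _; apply: le_trans (NC _ _) _.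
rewrite -mulrA ler_pM2l// mulrC.
have -> : iter t g e = iter (t * k.+1) (maxmul P) e by rewrite iterM.
by rewrite -exprM mulnC; exact: iterN.
Qed.

Lemma max_jsr_le_induced_norm {R : realType} {n : nat} (Psi : set 'M[R]_n)
    (N : 'cV[R]_n -> R) :
  (0 < n)%N -> (forall A, Psi A -> nonneg_mx A) -> Psi !=set0 -> is_norm N ->
  (max_jsr Psi <= ereal_sup [set max_induced_norm N A | A in Psi])%E.
Proof.
move=> n0 Psi_nonneg [A0 PsiA0] normN.
set S := ereal_sup _.
have NS A x : Psi A -> nonneg_mx x -> x != 0 -> ((N (maxmul A x) / N x)%:E <= S)%E.
  move=> PsiA x0 xN0; apply: le_trans (_ : (max_induced_norm N A <= S)%E).
    by apply: ereal_sup_ubound; exists x.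
  by apply: ereal_sup_ubound; exists A.
have S0 : (0 <= S)%E.
  (* Positivity of [n] makes the all-ones vector a nonzero test vector, which excludes the value
     [-oo]. *)
  pose x : 'cV[R]_n := const_mx 1.
  apply: le_trans (NS A0 x PsiA0 _ _).
  - by rewrite lee_fin divr_ge0 ?is_norm_ge0.
  - by move=> i j; rewrite mxE.
  - by apply/eqP => /matrixP/(_ (Ordinal n0) 0)/eqP; rewrite !mxE oner_eq0.
have {S0 NS} : S = +oo%E \/ exists2 c, 0 <= c & S = c%:E /\
    forall A x, Psi A -> nonneg_mx x -> N (maxmul A x) <= c * N x.
  case: S S0 NS => [c c0 NS|_ _|//]; [right|by left].
  exists c => //; split=> // A x PsiA x0.
  (* The supremum ranges over nonzero vectors, so zero is treated apart. *)
  have [->|xN0] := eqVneq x 0; last first.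
    by have := NS A x PsiA x0 xN0; rewrite lee_fin ler_pdivrMr// is_norm_gt0.
  rewrite (_ : maxmul A 0 = 0) ?is_norm0 ?mulr0//.
  apply/matrixP => i j; rewrite !mxE; apply: big1_idem => [|k _].
    exact: maxxx.
  by rewrite mxE mulr0.
case=> [->|[c c0 [-> Nc]]]; first exact: leey.
apply: limn_esup_le => m.
have Nprod s : (forall A, A \in s -> Psi A) -> forall x : 'cV[R]_n, nonneg_mx x ->
    N (maxmul (\big[maxmul/1%:M]_(A <- s) A) x) <= c ^+ size s * N x.
  elim: s => [|A s IH] Psis x x0; first by rewrite big_nil maxmul1mx// mul1r.
  have PsiA : Psi A by apply: Psis; rewrite mem_head.
  rewrite big_cons maxmulA//; [|exact: Psi_nonneg|exact: bigmaxmul_nonneg].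
  apply: le_trans (Nc A _ PsiA (maxmul_nonneg _ _)) _.
  rewrite exprS -mulrA ler_wpM2l// IH// => B Bs.
  by apply: Psis; rewrite inE Bs orbT.
have sup_le : (ereal_sup [set (max_cycle_gmean A)%:E | A in maxprods Psi m.+1]
    <= (c ^+ m.+1)%:E)%E.
  apply: ge_ereal_sup => _ [P /maxprodsP[s [sm Psis ->]] <-].
  rewrite lee_fin; apply: (max_cycle_gmean_le N) => //; last first.
    by rewrite -sm; exact: Nprod.
  - exact: exprn_ge0.
  - exact: bigmaxmul_nonneg.
have -> : c%:E = ((c ^+ m.+1)%:E `^ m.+1%:R^-1)%E.
  by rewrite poweR_EFin -powR_mulrn// -powRrM divff// powRr1.
(* Monotonicity of the root is used on [[0, +oo]]; a power of [A0] shows that the supremum lies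
   there. *)
have sup_ge0 : (0 <= ereal_sup [set (max_cycle_gmean A)%:E | A in maxprods Psi m.+1])%E.
  pose P := \big[maxmul/1%:M]_(A <- nseq m.+1 A0) A.
  apply: le_trans (_ : ((max_cycle_gmean P)%:E <= _)%E).
    by rewrite lee_fin; exact: bigmax_ge_id.
  apply: ereal_sup_ubound; exists P => //.
  apply/maxprodsP; exists (nseq m.+1 A0); rewrite size_nseq; split=> //.
  by move=> A; rewrite mem_nseq => /andP[_ /eqP ->].
by apply: (@gt0_ler_poweR _ m.+1%:R^-1 _ _ _ _ _ sup_le);
  rewrite ?invr_ge0// in_itv/= ?leey ?andbT// lee_fin exprn_ge0.
Qed.

Theorem proposition4p4 (R : realType) (n : nat) (n_gt0 : (0 < n)%N)
    (Psi : set 'M[R]_n)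
    (Psi_nonneg : forall A, Psi A -> nonneg_mx A)
    (Psi_neq0 : Psi !=set0)
    (Psi_bounded : bounded_set Psi) :
  max_jsr Psi =
  ereal_inf [set ereal_sup [set max_induced_norm N A | A in Psi]
              | N in [set N : 'cV[R]_n -> R | is_norm N]].
Proof.
apply/eqP; rewrite eq_le; apply/andP; split.
  by apply: le_ereal_inf_tmp => _ [N normN <-]; exact: max_jsr_le_induced_norm.
have : (0 <= max_jsr Psi)%E.
  by apply: limf_esup_ge0 => [|m]; [exact: filter_not_empty|exact: poweR_ge0].
move E : (max_jsr Psi) => [q|_|//]; last exact: leey.
(* The construction of a norm needs a number strictly above the radius, hence the slack [e]. *)
move=> _; apply/lee_addgt0Pr => e e0; rewrite -EFinD.
have [|N normN Nq] := jsr_lt_induced_norm_le Psi (q + e) Psi_nonneg Psi_bounded.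
  by rewrite E lte_fin ltrDl.
by apply: le_trans Nq; apply: ereal_inf_lbound; exists N.
Qed.
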